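(* Let $m = 2^j m_0$ with $j\ge 1$ and $m_0$ odd, and put $\beta_m = (m_0^2-1)/24$. For each of the following pairs consisting of a value of $m$ and a value of $B$, the congruence $$b_m\left(m_0^2 n - \beta_m + m_0 B\right) \equiv p_{m_0-2^j}(m_0 n + B) \pmod 2$$ holds for all integers $n\ge 0$: - $m_0=5$: $m=10$, $B\in\{1,3\}$; $m=20$, $B\in\{1,2\}$. - $m_0=7$: $m=14$, $B\in\{1,5,7\}$; $m=28$, $B\in\{2,3,5\}$. - $m_0=11$: $m=22$, $B\in\{1,5,6,7,9\}$; $m=44$, $B\in\{1,2,3,7,10\}$; $m=88$, $B\in\{2,3,4,6,9\}$. - $m_0=13$: $m=26$, $B\in\{3,6,7,8,9,12\}$; $m=52$, $B\in\{1,3,5,6,11,12\}$; $m=104$, $B\in\{2,6,9,10,11,12\}$. - $m_0=17$: $m=34$, $B\in\{3,5,6,8,9,11,15,16\}$; $m=68$, $B\in\{1,5,6,10,12,13,15,16\}$; $m=136$, $B\in\{2,3,7,9,10,12,13,15\}$; $m=272$, $B\in\{1,3,4,6,7,9,13,14\}$. - $m_0=19$: $m=38$, $B\in\{1,3,8,9,12,15,16,17,18\}$; $m=76$, $B\in\{2,5,6,11,13,15,16,17,18\}$; $m=152$, $B\in\{3,4,7,10,11,12,13,15,17\}$; $m=304$, $B\in\{1,3,5,6,7,8,11,14,15\}$. - $m_0=23$: $m=46$, $B\in\{3,5,8,9,12,13,15,17,18,19,20\}$; $m=92$, $B\in\{1,3,6,7,10,11,13,15,16,17,18\}$; $m=184$,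 $B\in\{2,3,6,7,9,11,12,13,14,20,22\}$; $m=368$, $B\in\{1,3,4,5,6,12,14,17,18,21,22\}$.
   Context: For a positive integer $m$, $b_m(n)$ denotes the number of $m$-regular partitions of $n$, i.e. partitions of $n$ none of whose parts is divisible by $m$; equivalently $\sum_{n\ge0} b_m(n)q^n = \prod_{i\ge1}(1-q^{mi})/(1-q^i)$. For a positive integer $t$, $p_t(n)$ denotes the number of $t$-multipartitions of $n$ (ordered $t$-tuples of partitions with total size $n$); equivalently $\sum_{n\ge0}p_t(n)q^n=\prod_{i\ge1}(1-q^i)^{-t}$.
   Formalization: For m=14 the formal statement has B in {1,5,6} instead of {1,5,7}: with B=7 and n=0 the congruence fails, since b_14(47)=114121 is odd and p_5(7)=2990 is even. *)

(* Defs.v *)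
From mathcomp Require Import all_boot.

Set Implicit Arguments.
Unset Strict Implicit.
Unset Printing Implicit Defensive.

Definition is_partition (s : seq nat) : bool := sorted geq s && (0 \notin s).

(* A partition of some k <= n has at most n parts, each of them at most n, so
   the bounded sequences n.-bseq 'I_n.+1 contain all of these partitions and
   form a finite type in which they can be counted. *)
Definition parts (n : nat) (s : n.-bseq 'I_n.+1) : seq nat :=
  [seq val i | i <- s].

Definition regular_partitions (m n : nat) : nat :=
  #|[set s : n.-bseq 'I_n.+1 |
      [&& is_partition (parts s),
          sumn (parts s) == n &
          all (fun k => ~~ (m %| k)) (parts s)]]|.

Definition multipartitions (t n : nat) : nat :=
  #|[set P : t.-tuple (n.-bseq 'I_n.+1) |
      all (fun s => is_partition (parts s)) P &&
      (\sum_(s <- P) sumn (parts s) == n)]|.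

(* The division is exact when m0 is coprime to 6, as all the odd parts
   5, 7, 11, 13, 17, 19, 23 occurring below are. *)
Definition beta (m0 : nat) : nat := (m0 ^ 2 - 1) %/ 24.

(* The pairs (m, set of admissible B). For m = 2 ^ j * m0 with m0 odd, every
   entry satisfies 2 ^ j < m0 and beta m0 <= m0 * B, so neither m0 - 2 ^ j nor
   m0 ^ 2 * n + m0 * B - beta m0 is affected by truncated subtraction.
   For m = 14 the third value is 6 and not 7: with B = 7 and n = 0 the two
   counts are 114121 and 2990. *)
Definition congruence_cases : seq (nat * seq nat) :=
  [:: (10, [:: 1; 3]);
      (20, [:: 1; 2]);

      (14, [:: 1; 5; 6]);
      (28, [:: 2; 3; 5]);

      (22, [:: 1; 5; 6; 7; 9]);
      (44, [:: 1; 2; 3; 7; 10]);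
      (88, [:: 2; 3; 4; 6; 9]);

      (26, [:: 3; 6; 7; 8; 9; 12]);
      (52, [:: 1; 3; 5; 6; 11; 12]);
      (104, [:: 2; 6; 9; 10; 11; 12]);

      (34, [:: 3; 5; 6; 8; 9; 11; 15; 16]);
      (68, [:: 1; 5; 6; 10; 12; 13; 15; 16]);
      (136, [:: 2; 3; 7; 9; 10; 12; 13; 15]);
      (272, [:: 1; 3; 4; 6; 7; 9; 13; 14]);

      (38, [:: 1; 3; 8; 9; 12; 15; 16; 17; 18]);
      (76, [:: 2; 5; 6; 11; 13; 15; 16; 17; 18]);
      (152, [:: 3; 4; 7; 10; 11; 12; 13; 15; 17]);
      (304, [:: 1; 3; 5; 6; 7; 8; 11; 14; 15]);

      (46, [:: 3; 5; 8; 9; 12; 13; 15; 17; 18; 19; 20]);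
      (92, [:: 1; 3; 6; 7; 10; 11; 13; 15; 16; 17; 18]);
      (184, [:: 2; 3; 6; 7; 9; 11; 12; 13; 14; 20; 22]);
      (368, [:: 1; 3; 4; 5; 6; 12; 14; 17; 18; 21; 22])].

(* Main.v *)
From Stdlib Require Import Setoid Morphisms.
Require Import Defs.
From mathcomp Require Import all_boot all_order all_algebra all_fingroup all_solvable all_field.
From mathcomp Require Import zify ring.

(** Put [p = m0], [s = 2^j], [h = (p - 1) / 2] and [f_k = (1 - q^k)(1 - q^2k)...],
    with coefficients in a field of characteristic 2, so that [f_k^2 = f_2k].
    The series of [b_m] and [p_(p - s)] are [f_p^s / f_1] and [1 / f_1^(p - s)].
    The triple product identity gives
      [f_p^p / f_1 = prod_(1 <= i <= h) sum_n q^(p n^2 + 2 i n)],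
    so that [f_1^(p - s) * sum_N b_m(p N - beta) q^N] counts the vectors [v] of
    [Z^h] congruent to [(1, ..., h)] modulo [p] by [N = |v|^2 / p^2]. A symmetric
    integer matrix [O] with [O^2 = p^2] and [O_ri = r i] modulo [p] maps them
    bijectively to the [n] in [Z^h] with [sum i n_i = 1] modulo [p], counted by
    [N = |n|^2]. Detecting the last congruence with [p]-th roots of unity, the
    triple product evaluates this second count to [1 + f_1^p / f_p]. Hence the
    series of the differences [b_m(p N - beta) - p_(p - s)(N)] is
    [f_1^s / f_p = f_s / f_p], and by the pentagonal number theorem its exponents
    are congruent modulo [p] to numbers [s n (3 n + 1) / 2]; the listed values of
    [B] avoid these residues. *)

Import Order.TTheory GRing.Theory Num.Theory.
Local Open Scope ring_scope.

(** * Congruence of power series modulo a power of ['X] *)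

Section Congruence.
Variable F : fieldType.
Implicit Types P Q S : {poly F}.

(* A power series is represented by any polynomial congruent to it modulo ['X^N]. *)
Definition eqm N P Q : Prop := 'X^N %| P - Q.

Lemma eqmP N P Q : eqm N P Q <-> (forall i, (i < N)%N -> P`_i = Q`_i).
Proof.
split=> [/dvdpP[S /eqP]|PQ].
  rewrite subr_eq => /eqP -> i iN.
  by rewrite coefD coefMXn iN add0r.
rewrite /eqm; have -> : P - Q = drop_poly N (P - Q) * 'X^N; last exact: dvdp_mull.
rewrite -[LHS](poly_take_drop N); set T := take_poly _ _.
suff -> : T = 0 by rewrite add0r.
apply/polyP=> i; rewrite coef_take_poly coef0 coefB.
by case: ifP => // /PQ ->; rewrite subrr.
Qed.

Lemma eqm_refl N P : eqm N P P.
Proof. by rewrite /eqm subrr dvdp0. Qed.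

Lemma eqm_sym N P Q : eqm N P Q -> eqm N Q P.
Proof. by rewrite /eqm -dvdpNr opprB. Qed.

Lemma eqm_trans N P Q S : eqm N P Q -> eqm N Q S -> eqm N P S.
Proof. by rewrite /eqm => PQ QS; rewrite -(subrKA Q) dvdp_add. Qed.

#[global] Instance eqm_equiv N : Equivalence (eqm N).
Proof.
split; [exact: eqm_refl | exact: eqm_sym | exact: eqm_trans].
Qed.

Lemma eqmD N P P' Q Q' : eqm N P P' -> eqm N Q Q' -> eqm N (P + Q) (P' + Q').
Proof. by rewrite /eqm opprD addrACA; exact: dvdp_add. Qed.

Lemma eqmM N P P' Q Q' : eqm N P P' -> eqm N Q Q' -> eqm N (P * Q) (P' * Q').
Proof.
rewrite /eqm => PP QQ.
have -> : P * Q - P' * Q' = (P - P') * Q + P' * (Q - Q') by ring.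
by apply: dvdp_add; [exact: dvdp_mulr | exact: dvdp_mull].
Qed.

#[global] Instance eqmD_proper N :
  Proper (eqm N ==> eqm N ==> eqm N) (@GRing.add _).
Proof. by move=> P P' PP Q Q' QQ; exact: eqmD. Qed.

#[global] Instance eqmM_proper N :
  Proper (eqm N ==> eqm N ==> eqm N) (@GRing.mul _).
Proof. by move=> P P' PP Q Q' QQ; exact: eqmM. Qed.

Lemma eqm_leq M N P Q : (M <= N)%N -> eqm N P Q -> eqm M P Q.
Proof. by move=> MN; apply: dvdp_trans; exact: dvdp_exp2l. Qed.

Lemma eqm_sum N I (r : seq I) (C : pred I) (f g : I -> {poly F}) :
  (forall i, C i -> eqm N (f i) (g i)) ->
  eqm N (\sum_(i <- r | C i) f i) (\sum_(i <- r | C i) g i).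
Proof.
move=> fg; elim/big_rec2: _ => [|i P Q Ci]; first exact: eqm_refl.
by move=> PQ; apply: eqmD => //; exact: fg.
Qed.

Lemma eqm_prod N I (r : seq I) (C : pred I) (f g : I -> {poly F}) :
  (forall i, C i -> eqm N (f i) (g i)) ->
  eqm N (\prod_(i <- r | C i) f i) (\prod_(i <- r | C i) g i).
Proof.
move=> fg; elim/big_rec2: _ => [|i P Q Ci]; first exact: eqm_refl.
by move=> PQ; apply: eqmM => //; exact: fg.
Qed.

Lemma eqm_exp N P Q k : eqm N P Q -> eqm N (P ^+ k) (Q ^+ k).
Proof.
by move=> PQ; elim: k => [|k IH]; rewrite ?expr0 ?exprS; [exact: eqm_refl|exact: eqmM].
Qed.

(** A polynomial with nonzero constant term is coprime to ['X^N], so it can be cancelled like an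
    invertible series. *)
Lemma eqm_mulI N P Q S :
  S`_0 != 0 -> eqm N (S * P) (S * Q) -> eqm N P Q.
Proof.
rewrite /eqm -mulrBr => S0; rewrite Gauss_dvdpr // coprimep_expl //.
by rewrite coprimep_sym coprimepX rootE horner_coef0.
Qed.

Lemma eqm_XnM N k P : (N <= k)%N -> eqm N ('X^k * P) 0.
Proof.
by move=> Nk; rewrite /eqm subr0 dvdp_mulr // dvdp_exp2l.
Qed.
End Congruence.
Arguments eqm {F}.
Arguments eqmP {F N P Q}.
Arguments eqm_refl {F N P}.
Arguments eqm_sym {F N P Q}.
Arguments eqm_trans {F N P Q S}.
Arguments eqm_sum {F N I r C}.
Arguments eqm_prod {F N I r C}.
Arguments eqm_leq {F M N P Q}.
Arguments eqmM {F N P P' Q Q'}.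
Arguments eqm_mulI {F N P Q S}.

(** * Gaussian binomial coefficients *)

Section QBinomial.
Variables (R : comNzRingType) (q : R).

(** The Pascal recurrence serves as definition because [1 - q ^+ i] need not be invertible in
    [R]. *)
Fixpoint qbin n k : R :=
  match n, k with
  | _, 0%N => 1
  | 0%N, _.+1 => 0
  | n'.+1, k'.+1 => qbin n' k' + q ^+ k * qbin n' k
  end.

Lemma qbin0 n : qbin n 0 = 1. Proof. by case: n. Qed.

Lemma qbinS n k : qbin n.+1 k.+1 = qbin n k + q ^+ k.+1 * qbin n k.+1.
Proof. by []. Qed.

Lemma qbin_small n k : (n < k)%N -> qbin n k = 0.
Proof.
elim: n k => [|n IH] [|k] // nk.
by rewrite qbinS (IH k) // (IH k.+1) ?mulr0 ?addr0 // ltnW.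
Qed.

(** This ratio of neighbouring coefficients, written without division, links the two Pascal rules
    and yields the product formula. *)
Lemma qbin_step n k : (k <= n)%N ->
  (1 - q ^+ k.+1) * qbin n k.+1 = (1 - q ^+ (n - k)) * qbin n k.
Proof.
elim: n k => [|n IH] k kn.
  by rewrite sub0n expr0 subrr mul0r qbin_small // mulr0.
have absorb j : (j <= n)%N ->
    (1 - q ^+ j.+1) * qbin n.+1 j.+1 = (1 - q ^+ n.+1) * qbin n j.
  move=> jn; rewrite qbinS mulrDr mulrCA IH // mulrA.
  have -> : q ^+ n.+1 = q ^+ j.+1 * q ^+ (n - j) by rewrite -exprD; congr (_ ^+ _); lia.
  by ring.
case: k kn => [|k] kn; first by rewrite absorb // !qbin0 subn0.
move: kn; rewrite ltnS leq_eqVlt => /orP[/eqP ->|kn].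
  by rewrite subnn expr0 subrr mul0r qbin_small // mulr0.
rewrite absorb // subSS [in RHS]qbinS mulrDr -IH ?(ltnW kn) //.
have -> : q ^+ n.+1 = q ^+ k.+1 * q ^+ (n - k) by rewrite -exprD; congr (_ ^+ _); lia.
by ring.
Qed.

(** The mirrored Pascal rule differs from [qbinS] by exactly the identity [qbin_step]. *)
Lemma qbinS2 n k : (k <= n)%N ->
  qbin n.+1 k.+1 = q ^+ (n - k) * qbin n k + qbin n k.+1.
Proof.
move=> /qbin_step E; apply/eqP; rewrite -subr_eq0 qbinS; apply/eqP.
transitivity ((1 - q ^+ (n - k)) * qbin n k - (1 - q ^+ k.+1) * qbin n k.+1).
  by ring.
by rewrite E subrr.
Qed.

Definition qpoch n := \prod_(i < n) (1 - q ^+ i.+1).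

Lemma qbin_qpoch n k : (k <= n)%N -> qbin n k * (qpoch k * qpoch (n - k)) = qpoch n.
Proof.
elim: n k => [|n IH] [|k] kn //; rewrite ?qbin0 ?subn0 /qpoch.
- by rewrite !big_ord0 !mul1r.
- by rewrite big_ord0 !mul1r.
rewrite subSS -/(qpoch _) -/(qpoch _) -/(qpoch _).
have -> : qpoch k.+1 = qpoch k * (1 - q ^+ k.+1) by rewrite /qpoch big_ord_recr.
have -> : qpoch n.+1 = qpoch n * (1 - q ^+ n.+1) by rewrite /qpoch big_ord_recr.
rewrite -(IH k) // qbinS.
have -> : q ^+ n.+1 = q ^+ k.+1 * q ^+ (n - k) by rewrite -exprD; congr (_ ^+ _); lia.
have E := qbin_step n k kn.
transitivity (((1 - q ^+ k.+1) * qbin n k + q ^+ k.+1 * ((1 - q ^+ k.+1) * qbin n k.+1))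
   * qpoch k * qpoch (n - k)); first by ring.
by rewrite E; ring.
Qed.

End QBinomial.
Arguments qbin : simpl never.

(* With n = k - m as an integer, tri k m = n(n+1)/2 and tri m k = n(n-1)/2. *)
Definition tri k m := ('C((k - m).+1, 2) + 'C(m - k, 2))%N.

Lemma triS_l k m : (tri k.+1 m + m = tri k m + k.+1)%N.
Proof.
rewrite /tri; have [mk|km] := leqP m k.
  have -> : (k.+1 - m = (k - m).+1)%N by lia.
  have -> : (m - k.+1 = 0)%N by lia.
  have -> : (m - k = 0)%N by lia.
  by rewrite (binS (k - m).+1) bin1; lia.
have -> : (m - k = (m - k.+1).+1)%N by lia.
have -> : (k.+1 - m = 0)%N by lia.
have -> : (k - m = 0)%N by lia.
by rewrite (binS (m - k.+1)) bin1 (_ : 'C(1, 2) = 0)%N //; lia.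
Qed.

Lemma triS_r k m : (tri m k.+1 + m = tri m k + k)%N.
Proof.
have := triS_l m k.+1; have := triS_l m k.
have -> : tri m.+1 k.+1 = tri m k by rewrite /tri !subSS.
lia.
Qed.

Lemma tri_sum k m : (tri k m + tri m k = (k - m) ^ 2 + (m - k) ^ 2)%N.
Proof.
have sq x : ('C(x.+1, 2) + 'C(x, 2) = x ^ 2)%N.
  elim: x => // x; rewrite (binS x.+1 1) (binS x 1) !bin1 !expnS !expn0 !muln1; nia.
by rewrite /tri -!sq; lia.
Qed.

(** * The Jacobi triple product *)

Section TripleProduct.
Variables (R : comNzRingType) (A B : R).
Let Q := A * B.

(** With [A] and [B] in place of the usual [z] and [q], no negative powers occur. A new factor
    [1 + A * Q ^+ M] is absorbed by the Pascal rule [qbinS2], a new factor [1 + B * Q ^+ m] by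
    [qbinS]. *)
Lemma triple_product_finite M m :
  \prod_(k < M) (1 + A * Q ^+ k) * \prod_(k < m) (1 + B * Q ^+ k)
  = \sum_(k < (M + m).+1) qbin _ Q (M + m) k * (A ^+ tri k m * B ^+ tri m k).
Proof.
elim: M => [|M IH]; last first.
  rewrite big_ord_recr /= mulrAC IH mulrDr mulr1 mulr_suml addSn.
  rewrite [RHS]big_ord_recl qbin0 mul1r /=.
  under [in RHS]eq_bigr => i _ do
    rewrite /bump /= ?add1n qbinS2 ?leq_ord // mulrDl.
  rewrite big_split /= addrCA [LHS]addrC; congr (_ + _); last first.
    rewrite [RHS]addrC [in RHS]big_ord_recr /= qbin_small // mul0r addr0.
    rewrite big_ord_recl qbin0 mul1r addrC; congr (_ + _).
  apply: eq_bigr => i _; rewrite -!mulrA [RHS]mulrCA; congr (_ * _).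
  rewrite /Q !exprMn.
  have E1 := triS_l i m; have E2 := triS_r i m.
  have ? := leq_ord i.
  transitivity (A ^+ (tri i m + M.+1) * B ^+ (tri m i + M)).
    by rewrite !exprD exprS; ring.
  transitivity (A ^+ (M + m - i + tri i.+1 m) * B ^+ (M + m - i + tri m i.+1)).
    by congr (_ ^+ _ * _ ^+ _); lia.
  by rewrite !exprD; ring.
rewrite big_ord0 mul1r add0n; elim: m => [|m IH].
  by rewrite big_ord0 big_ord1 /= /tri /= !mul1r.
rewrite big_ord_recr /= IH mulrDr mulr1 mulr_suml.
rewrite [RHS]big_ord_recl qbin0 mul1r.
under [in RHS]eq_bigr => i _ do
  rewrite /bump /= ?add1n qbinS mulrDl.
rewrite big_split /= addrCA; congr (_ + _).
rewrite big_ord_recl [in RHS]big_ord_recr /= (qbin_small _ _ m m.+1) // mulr0 mul0r addr0.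
have step k : A ^+ tri k m * B ^+ tri m k * (B * Q ^+ m)
              = Q ^+ k * (A ^+ tri k m.+1 * B ^+ tri m.+1 k).
  rewrite /Q !exprMn.
  have E1 := triS_r m k; have E2 := triS_l m k.
  transitivity (A ^+ (tri k m + m) * B ^+ (tri m k + m.+1)).
    by rewrite !exprD exprS; ring.
  transitivity (A ^+ (k + tri k m.+1) * B ^+ (k + tri m.+1 k)).
    by congr (_ ^+ _ * _ ^+ _); lia.
  by rewrite !exprD; ring.
congr (_ + _).
  by rewrite qbin0 mul1r step expr0 mul1r.
apply: eq_bigr => i _; rewrite /bump /= ?add1n -!mulrA [in RHS]mulrCA; congr (_ * _).
by rewrite -step !mulrA.
Qed.
End TripleProduct.

Section Truncation.
Variable F : fieldType.
Implicit Types A B Q : {poly F}.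

Lemma prod_trunc N M L (g : nat -> {poly F}) : (M <= L)%N ->
  (forall i, (M <= i)%N -> eqm N (g i) 1) ->
  eqm N (\prod_(i < L) g i) (\prod_(i < M) g i).
Proof.
move=> ML g1; rewrite -!(big_mkord xpredT) (@big_cat_nat _ _ _ M) //=.
set P := \prod_(_ <= _ < L) _.
have -> : eqm N P 1.
  rewrite /P big_nat_cond; have {2}-> : 1 = \prod_(M <= i < L | (M <= i < L)%N && true) (1 : {poly F}).
    by rewrite big1.
  by apply: eqm_prod => i /andP[/andP[/g1]].
by rewrite mulr1; exact: eqm_refl.
Qed.

(** This is the limit of the finite identity at [M = m = N]: multiplied by the infinite product of
    the [1 - Q^i], each central Gaussian binomial tends to 1. *)
Lemma triple_product N A B : 'X %| A -> 'X %| B -> let Q := A * B in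
  eqm N (\prod_(k < N) (1 + A * Q ^+ k) * \prod_(k < N) (1 + B * Q ^+ k)
           * qpoch _ Q N)
        (\sum_(k < (N + N).+1) A ^+ tri k N * B ^+ tri N k).
Proof.
move=> XA XB Q; rewrite triple_product_finite.
have XQ k : 'X^k %| Q ^+ k by rewrite dvdp_exp2r // dvdp_mulr.
have pochE n L : (n <= L)%N -> eqm n.+1 (qpoch _ Q L) (qpoch _ Q n).
  move=> nL; apply: (prod_trunc _ _ _ (fun i => 1 - Q ^+ i.+1)) => // i ni.
  rewrite /eqm addrAC subrr add0r dvdpNr.
  by apply: dvdp_trans (XQ _); rewrite dvdp_exp2l // ltnS.
set E := qpoch _ Q (N + N).
have E0 : E`_0 != 0.
  have /eqmP : eqm 1 E 1 by have := pochE 0%N (N + N)%N (leq0n _); rewrite /qpoch big_ord0.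
  by move=> ->; rewrite ?coef1 ?oner_eq0.
have -> : eqm N (qpoch _ Q N) E.
  apply: eqm_sym; apply: (@eqm_leq _ _ N.+1) => //.
  by apply: pochE; rewrite leq_addr.
rewrite mulr_suml; apply: eqm_sum => k _; rewrite mulrAC.
have kN := leq_ord k.
set b := qbin _ _ _ _; set r := minn k (N + N - k).
(* Modulo ['X^(r.+1)], [E] agrees with both [qpoch] factors in the denominator of [b]. *)
have bE : eqm r.+1 (b * E) 1.
  apply: (eqm_mulI E0); rewrite mulr1 -[X in eqm _ _ X](qbin_qpoch _ _ _ k) // -/b.
  rewrite mulrCA; apply: eqmM; first exact: eqm_refl.
  apply: eqmM; [apply: (@eqm_leq _ _ k.+1) | apply: (@eqm_leq _ _ (N + N - k).+1)];
    by [rewrite /r; lia | apply: pochE; lia].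
rewrite /eqm -[X in _ - X]mul1r -mulrBl.
(* With [d = |k - N|], the error of the coefficient has order at least [N - d + 1], the monomial has
   order at least [d^2], and [N - d + 1 + d^2 >= N]. *)
apply: (@dvdp_trans _ ('X^(r.+1) * ('X^(tri k N) * 'X^(tri N k)))).
  rewrite -!exprD dvdp_exp2l // tri_sum /r; nia.
by rewrite dvdp_mul // dvdp_mul // dvdp_exp2r.
Qed.
End Truncation.

(** * Regrouping of finite products *)

Lemma prod_regroup (R : comNzRingType) a N (g : nat -> R) :
  \prod_(i < N * a) g i = \prod_(k < N) \prod_(r < a) g (k * a + r)%N.
Proof.
rewrite -(big_mkord xpredT g) big_nat_mul big_mkord; apply: eq_bigr => k _.
by rewrite mulSn -{1}[(k * a)%N]add0n big_addn addnK big_mkord; apply: eq_bigr => r _; rewrite addnC.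
Qed.

Lemma prod_rev (R : comNzRingType) h (g : nat -> R) :
  \prod_(i < h) g i = \prod_(i < h) g (h - i.+1)%N.
Proof. by rewrite (reindex_inj rev_ord_inj). Qed.

(** For [p = 2 h + 1], the odd numbers [2 (k p + r) + 1] lie symmetrically about the multiple
    [p (2 k + 1)], which is the one with [r = h]. *)
Lemma prod_center (R : comNzRingType) h (g : nat -> R) :
  \prod_(r < h.*2.+1) g r
  = g h * \prod_(i < h) (g (h + i.+1)%N * g (h - i.+1)%N).
Proof.
have -> : h.*2.+1 = (h + h.+1)%N by lia.
rewrite big_split_ord /= big_ord_recl /= prod_rev addn0 big_split /=.
by rewrite mulrCA [X in _ = _ * X]mulrC.
Qed.

(** The pairs [r], [p - r] with [p = 2 h + 1] are opposite exponents of a [p]-th root of unity. *)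
Lemma prod_wings (R : comNzRingType) h (g : nat -> R) :
  \prod_(r < h.*2.+1) g r
  = g 0%N * \prod_(i < h) (g i.+1 * g (h.*2.+1 - i.+1)%N).
Proof.
rewrite big_ord_recl /=; congr (_ * _).
have -> : h.*2 = (h + h)%N by lia.
rewrite big_split_ord /= big_split /=; congr (_ * _).
rewrite (prod_rev _ _ (fun i => g (bump 0 (h + i)))); apply: eq_bigr => i _.
by congr g; have := ltn_ord i; rewrite /bump /=; lia.
Qed.

(** * Euler products in characteristic 2 *)

Section CharTwo.
Variable F : fieldType.
Hypothesis F2 : 2%N \in [pchar F].
Variable N : nat.
Implicit Types P Q : {poly F}.

Let polyF2 : 2%N \in [pchar {poly F}].
Proof. by rewrite pchar_poly. Qed.

(** The series [f_k] cut to [N] factors, with [+] for [-]. As a finite product it satisfies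
    [euler_pow2] and [euler_comp] exactly, not merely modulo ['X^N]. *)
Definition euler k : {poly F} := \prod_(j < N) (1 + 'X^(k * j.+1)).
Definition euler_odd k : {poly F} := \prod_(j < N) (1 + 'X^(k * j.*2.+1)).

Lemma sqrrD_char2 P Q : (P + Q) ^+ 2 = P ^+ 2 + Q ^+ 2.
Proof. by rewrite sqrrD mulr2n addrr_pchar2 // addr0. Qed.

Lemma euler_pow2 k j : euler (2 ^ j * k) = euler k ^+ (2 ^ j).
Proof.
elim: j => [|j IH]; first by rewrite expn0 mul1n expr1.
rewrite expnSr exprM -IH /euler -prodrXl; apply: eq_bigr => i _.
by rewrite sqrrD_char2 expr1n -exprM; congr (_ + 'X^_); lia.
Qed.

Lemma euler_comp k : euler k = euler 1 \Po 'X^k.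
Proof.
rewrite /euler rmorph_prod; apply: eq_bigr => i _ /=.
by rewrite rmorphD /= comp_polyC rmorphXn /= comp_polyX mul1n exprM.
Qed.

Lemma qpoch_char2 Q : qpoch _ Q N = \prod_(j < N) (1 + Q ^+ j.+1).
Proof. by apply: eq_bigr => i _; rewrite oppr_pchar2. Qed.

Lemma eqm_1DXn k : (N <= k)%N -> eqm N (1 + 'X^k : {poly F}) 1.
Proof. by move=> Nk; rewrite /eqm addrAC subrr add0r dvdp_exp2l. Qed.

Lemma coef0_prod (I : Type) (r : seq I) (C : pred I) (g : I -> {poly F}) :
  (\prod_(i <- r | C i) g i)`_0 = \prod_(i <- r | C i) (g i)`_0.
Proof. by elim/big_rec2: _ => [|i x y _ <-]; rewrite ?coef1 // coef0M. Qed.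

Lemma euler_coef0 k : (0 < k)%N -> (euler k)`_0 != 0.
Proof.
move=> k0; rewrite coef0_prod big1 ?oner_eq0 // => i _.
by rewrite coefD coef1 coefXn eqxx eqn_leq leqn0 muln_eq0 gtn_eqF //= addr0.
Qed.

(** Odd and even multiples of [k] together give [euler_odd k * f_2k = f_k], while [f_2k = f_k^2]. *)
Lemma euler_odd_inv k : (0 < k)%N -> eqm N (euler_odd k * euler k) 1.
Proof.
move=> k0; apply: (eqm_mulI (euler_coef0 k k0)); rewrite mulr1 mulrCA.
have -> : euler k * euler k = euler (2 ^ 1 * k) by rewrite euler_pow2.
have -> : euler_odd k * euler (2 ^ 1 * k) = \prod_(i < N * 2) (1 + 'X^(k * i.+1)).
  rewrite (prod_regroup _ 2 N (fun i => 1 + 'X^(k * i.+1))) /euler /euler_odd -big_split /=.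
  apply: eq_bigr => i _; rewrite big_ord_recl big_ord1 /= /bump /=.
  by congr ((1 + 'X^_) * (1 + 'X^_)); lia.
apply: (prod_trunc _ N N (N * 2) (fun i => 1 + 'X^(k * i.+1))); first by lia.
by move=> i Ni; apply: eqm_1DXn; nia.
Qed.

Lemma triple_product_char2 A B Q : A * B = Q -> A`_0 = 0 -> B`_0 = 0 ->
  eqm N (\prod_(k < N) ((1 + A * Q ^+ k) * (1 + B * Q ^+ k) * (1 + Q ^+ k.+1)))
        (\sum_(k < (N + N).+1) A ^+ tri k N * B ^+ tri N k).
Proof.
move=> <- A0 B0; rewrite !big_split /= -qpoch_char2.
by apply: triple_product; rewrite -['X]subr0 -polyC0 dvdp_XsubCl rootE horner_coef0 ?A0 ?B0.
Qed.

(** The triple product at [A = 'X^(2k)] and [B = 'X^k], whose three products sort the multiples of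
    [k] by residue modulo 3. With [n = i - N] the exponent is [k n (3 n + 1) / 2]. *)
Lemma euler_pentagonal k : (0 < k)%N ->
  eqm N (euler k) (\sum_(i < (N + N).+1) 'X^(k * (2 * tri i N + tri N i))).
Proof.
move=> k0.
have Xk0 j : (0 < j)%N -> 'X^j`_0 = 0 :> F by case: j => // j _; rewrite coefXn.
have := triple_product_char2 ('X^(k * 2)) ('X^k) ('X^(k * 3)) _ (Xk0 _ _) (Xk0 _ _).
rewrite -exprD -mulnSr muln_gt0 k0 => /(_ erefl erefl erefl) JTP.
apply: eqm_trans (eqm_sym _) _; last apply: eqm_trans _ _; last 1 first.
- rewrite (eq_bigr (fun i : 'I__ => 'X^(k * 2) ^+ tri i N * 'X^k ^+ tri N i)); first exact: JTP.
  by move=> i _; rewrite -!exprM -exprD; congr ('X^_); lia.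
- apply: (prod_trunc _ N N (N * 3) (fun i => 1 + 'X^(k * i.+1))); first by lia.
  by move=> i Ni; apply: eqm_1DXn; nia.
rewrite (prod_regroup _ 3 N (fun i => 1 + 'X^(k * i.+1))).
rewrite (eq_bigr (fun i : 'I_N => (1 + 'X^(k * 2) * 'X^(k * 3) ^+ i)
  * (1 + 'X^k * 'X^(k * 3) ^+ i) * (1 + 'X^(k * 3) ^+ i.+1))); first exact: eqm_refl.
move=> i _; rewrite !big_ord_recl big_ord0 mulr1 /= /bump /= mulrA.
rewrite [X in X * _ = _]mulrC -!exprM -!exprD.
by congr ((1 + 'X^_) * (1 + 'X^_) * (1 + 'X^_)); lia.
Qed.

(** * Theta series attached to an odd order [p] *)

Section OddOrder.
Variable h : nat.
Let p := h.*2.+1.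

(** With [n = k - N] the exponent is [p n^2 + 2 (i + 1) n]. *)
Definition theta_shifted i : {poly F} :=
  \sum_(k < (N + N).+1) ('X^(p + i.+1.*2)) ^+ tri k N * ('X^(p - i.+1.*2)) ^+ tri N k.

(** Over all [i], the triple products contain each factor [1 + q^a] with [a] odd and not divisible
    by [p] once. The missing odd multiples of [p] come from [euler_odd p], and the [h] factors
    [f_2p] make [f_p^(2 h)]. *)
Lemma prod_theta_shifted :
  eqm N (euler 1 * \prod_(i < h) theta_shifted i) (euler p ^+ p).
Proof.
pose A i : {poly F} := 'X^(p + i.+1.*2); pose B i : {poly F} := 'X^(p - i.+1.*2).
have AB (i : 'I_h) : A i * B i = 'X^(p.*2).
  by rewrite -exprD; congr ('X^_); have := ltn_ord i; rewrite /p; lia.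
have E2p : \prod_(j < N) (1 + 'X^(p.*2) ^+ j.+1) = euler p ^+ 2.
  rewrite -[2%N in RHS]expn1 -euler_pow2; apply: eq_bigr => j _.
  by rewrite -exprM; congr (_ + 'X^_); lia.
have Xk0 j : (0 < j)%N -> 'X^j`_0 = 0 :> F by case: j => // j _; rewrite coefXn.
pose W := \prod_(k < N) \prod_(i < h) ((1 + A i * 'X^(p.*2) ^+ k) * (1 + B i * 'X^(p.*2) ^+ k)).
have JTP : eqm N (\prod_(i < h) theta_shifted i) (W * euler p ^+ h.*2).
  rewrite -mul2n exprM -E2p -[h in _ ^+ h]card_ord -prodr_const /W exchange_big -big_split /=.
  apply: eqm_prod => i _; rewrite -big_split /=; apply: eqm_sym.
  apply: triple_product_char2; first exact: AB.
    by apply: Xk0.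
  by apply: Xk0; have := ltn_ord i; rewrite /p; lia.
have WE : eqm N (W * euler_odd p) (euler_odd 1).
  rewrite /W /euler_odd -big_split /=.
  apply: eqm_trans (_ : eqm N (\prod_(i < N * p) (1 + 'X^(1 * i.*2.+1))) _); last first.
    apply: (prod_trunc _ N N (N * p) (fun i => 1 + 'X^(1 * i.*2.+1))); first by rewrite /p; nia.
    by move=> i Ni; apply: eqm_1DXn; lia.
  rewrite (prod_regroup _ p N (fun i => 1 + 'X^(1 * i.*2.+1))).
  apply: eqm_prod => k _.
  rewrite (prod_center _ h (fun r => 1 + 'X^(1 * (k * p + r).*2.+1))) mulrC.
  rewrite (_ : 1 + 'X^(p * k.*2.+1) = 1 + 'X^(1 * (k * p + h).*2.+1)); last first.
    by congr (_ + 'X^_); rewrite /p; lia.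
  apply: eqmM; first exact: eqm_refl.
  apply: eqm_prod => i _.
  have i_h := ltn_ord i.
  rewrite -!exprM -!exprD.
  rewrite (_ : p + i.+1.*2 + p.*2 * k = 1 * (k * p + (h + i.+1)).*2.+1)%N; last by rewrite /p; lia.
  rewrite (_ : p - i.+1.*2 + p.*2 * k = 1 * (k * p + (h - i.+1)).*2.+1)%N; last by rewrite /p; lia.
  exact: eqm_refl.
have p0 : (0 < p)%N by [].
have -> : euler p ^+ p = euler p ^+ h.*2 * euler p by rewrite -exprSr.
rewrite JTP.
transitivity (euler 1 * (W * euler p ^+ h.*2) * (euler_odd p * euler p)).
  by rewrite euler_odd_inv // mulr1; exact: eqm_refl.
rewrite (_ : _ * _ = (euler_odd p * W) * euler 1 * (euler p ^+ h.*2 * euler p)); last by ring.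
rewrite (mulrC (euler_odd p)) WE euler_odd_inv // mul1r; exact: eqm_refl.
Qed.

(** When [w^p = 1], [w ^+ (i.+1 * h.*2)] is the inverse of [w ^+ i.+1], so the factor of [i] is the
    sum of [w^((i + 1) n) q^(n^2)] over [|n| <= N]. *)
Definition theta_twisted (w : F) : {poly F} :=
  \prod_(i < h) \sum_(k < (N + N).+1)
     ((w ^+ i.+1)%:P * 'X) ^+ tri k N * ((w ^+ (i.+1 * h.*2))%:P * 'X) ^+ tri N k.

(** In the sum of [q^(n^2)] the terms of [n] and [-n] cancel in characteristic 2. The proof reads
    this off the product side, as the square of [euler_odd_inv]. *)
Lemma theta_twisted1 : eqm N (theta_twisted 1) 1.
Proof.
apply: (eqm_trans (_ : eqm N _ (\prod_(i < h) 1))); last by rewrite big1 //; exact: eqm_refl.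
apply: eqm_prod => i _; rewrite !expr1n polyC1 mul1r.
have := triple_product_char2 'X 'X ('X ^+ 2) _ _ _; rewrite !coefX => /(_ erefl erefl erefl).
move/eqm_sym => JTP; apply: eqm_trans JTP _.
rewrite (eq_bigr (fun k : 'I_N => (1 + 'X^(1 * k.*2.+1)) * (1 + 'X^(1 * k.*2.+1))
    * (1 + 'X^(2 ^ 1 * 1 * k.+1)))).
  rewrite !big_split /= -/(euler_odd 1) -/(euler (2 ^ 1 * 1)) euler_pow2 expr2 mulrACA.
  by rewrite !euler_odd_inv // mulr1; exact: eqm_refl.
move=> k _; rewrite -!exprM -!exprS.
by congr ((1 + 'X^_) * (1 + 'X^_) * (1 + 'X^_)); lia.
Qed.

(** Let [v] be the inverse of [w]. Multiplying the factor of [r] by [v ^+ r] gives the factorization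
    of ['X^p - 1] evaluated at [Q], and these multipliers have product 1. *)
Lemma prod_prim_root (w : F) Q : p.-primitive_root w ->
  \prod_(r < p) (1 + (w ^+ r)%:P * Q) = 1 + Q ^+ p.
Proof.
move=> prim_w; pose v := w ^+ h.*2.
have vw : v * w = 1 by rewrite -exprSr prim_expr_order.
have prim_v : p.-primitive_root v by rewrite prim_root_exp_coprime // coprimenS.
have factor P : \prod_(r < p) ((v ^+ r)%:P + P) = 1 + P ^+ p.
  have /(congr1 (comp_poly P)) := factor_Xn_sub_1 prim_v.
  rewrite big_mkord rmorph_prod rmorphB /= comp_Xn_poly rmorph1 oppr_pchar2 // addrC => <-.
  apply: eq_bigr => r _.
  by rewrite rmorphB /= comp_polyX comp_polyC oppr_pchar2 // addrC.
have v1 : \prod_(r < p) (v ^+ r)%:P = 1 :> {poly F}.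
  transitivity (\prod_(r < p) ((v ^+ r)%:P + 0) : {poly F}); last by rewrite factor expr0n addr0.
  by apply: eq_bigr => r _; rewrite addr0.
rewrite -factor -[LHS]mul1r -[X in X * _]v1 -big_split; apply: eq_bigr => r _ /=.
by rewrite mulrDr mulr1 mulrA -polyCM -exprMn vw expr1n mul1r.
Qed.

(** For odd [a] the factors [1 + w^r q^a] multiply to [1 + q^(p a)]; the one with [r = 0] is missing
    from the triple products and comes from [euler_odd 1]. *)
Lemma theta_twistedE (w : F) : p.-primitive_root w ->
  eqm N (theta_twisted w * euler p) (euler 1 ^+ p).
Proof.
move=> prim_w.
pose A i : {poly F} := (w ^+ i.+1)%:P * 'X.
pose B i : {poly F} := (w ^+ (i.+1 * h.*2))%:P * 'X.
have AB i : A i * B i = 'X^2.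
  rewrite /A /B mulrACA -polyCM -exprD -mulnS mulnC exprM (prim_expr_order prim_w).
  by rewrite expr1n mul1r.
pose W := \prod_(k < N) \prod_(i < h) ((1 + A i * 'X^2 ^+ k) * (1 + B i * 'X^2 ^+ k)).
have E2 : \prod_(j < N) (1 + 'X^2 ^+ j.+1) = euler 1 ^+ 2.
  rewrite -[2%N in RHS]expn1 -euler_pow2; apply: eq_bigr => j _.
  by rewrite -exprM; congr (_ + 'X^_); lia.
have JTP : eqm N (theta_twisted w) (W * euler 1 ^+ h.*2).
  rewrite -mul2n exprM -E2 -[h in _ ^+ h]card_ord -prodr_const /W exchange_big -big_split /=.
  apply: eqm_prod => i _; rewrite -big_split /=; apply: eqm_sym.
  by apply: triple_product_char2; [exact: AB | |]; rewrite coefMX.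
have WE : W * euler_odd 1 = euler_odd p.
  rewrite /W /euler_odd -big_split /=; apply: eq_bigr => k _.
  rewrite (_ : 'X^(p * k.*2.+1) = 'X^(k.*2.+1) ^+ p); last by rewrite -exprM mulnC.
  rewrite -(prod_prim_root w) //.
  rewrite (prod_wings _ h (fun r => 1 + (w ^+ r)%:P * 'X^(k.*2.+1))) expr0 mul1r mulrC mul1n.
  congr (_ * _); apply: eq_bigr => i _.
  have E : 'X * 'X^2 ^+ k = 'X^(k.*2.+1) :> {poly F} by rewrite -exprM -exprS mul2n.
  rewrite /A /B -!mulrA E; congr (_ * (1 + _%:P * _)).
  rewrite -(prim_expr_mod prim_w (i.+1 * h.*2)); congr (_ ^+ _).
  have i_h := ltn_ord i.
  rewrite (_ : i.+1 * h.*2 = (i * p + (p - i.+1)))%N; last by rewrite /p; nia.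
  by rewrite modnMDl modn_small // /p; lia.
have -> : euler 1 ^+ p = euler 1 ^+ h.*2 * euler 1 by rewrite -exprSr.
rewrite JTP.
transitivity (W * euler 1 ^+ h.*2 * euler p * (euler_odd 1 * euler 1)).
  by rewrite euler_odd_inv // mulr1; exact: eqm_refl.
rewrite (_ : _ * _ = (W * euler_odd 1 * euler p) * (euler 1 ^+ h.*2 * euler 1)); last by ring.
by rewrite WE euler_odd_inv // mul1r; exact: eqm_refl.
Qed.

(** A vector [n] of [Z^h] with entries between [-N] and [N], stored as [n_i + N]; [norm2] is then
    its squared length. *)
Definition box := {ffun 'I_h -> 'I_(N + N).+1}.

Definition norm2 (f : box) := (\sum_(i < h) (tri (f i) N + tri N (f i)))%N.

(* congruent modulo [p] to the sum of the [i.+1 * (f i - N)] *)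
Definition moment (f : box) :=
  (\sum_(i < h) i.+1 * (tri (f i) N + h.*2 * tri N (f i)))%N.

Lemma theta_twisted_sum (w : F) :
  theta_twisted w = \sum_(f : box) (w ^+ moment f)%:P * 'X^(norm2 f).
Proof.
rewrite /theta_twisted bigA_distr_bigA; apply: eq_bigr => f _.
rewrite /moment /norm2 -!prodrXr rmorph_prod -big_split /=; apply: eq_bigr => i _.
rewrite !exprMn mulrACA -exprD; congr (_ * _).
by rewrite -!rmorphXn -rmorphM /= -!exprM -exprD mulnDr mulnA.
Qed.

(** When the residue is detected by characters, [c = 0] contributes 1 by [theta_twisted1]. Every
    other [c] contributes [f_1^p / f_p] with weight [z^(-c)], and these weights sum to [-1 = 1]. *)
Lemma sum_box_moment1 (z : F) : prime p -> p.-primitive_root z ->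
  eqm N ((\sum_(f : box | moment f == 1 %[mod p]) 'X^(norm2 f)) * euler p)
        (euler p + euler 1 ^+ p).
Proof.
move=> p_pr prim_z.
have geom (x : F) : x ^+ p = 1 -> x != 1 -> \sum_(c < p) x ^+ c = 0.
  move=> xp x1; have x10 : x - 1 != 0 by rewrite subr_eq0.
  apply: (mulfI x10).
  by rewrite mulr0 -subrX1 xp subrr.
have zp x : (z ^+ x) ^+ p = 1 by rewrite exprAC (prim_expr_order prim_z) expr1n.
(* [h.*2] is [-1] modulo [p], so the summand is [z^(c (moment f - 1))]. As [p] is odd, a sum of [p]
   ones equals 1 in [F]. *)
have detect f : \sum_(c < p) z ^+ (c * h.*2) * (z ^+ c) ^+ moment f
    = (moment f == 1 %[mod p])%:R.
  transitivity (\sum_(c < p) (z ^+ (h.*2 + moment f)) ^+ c).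
    by apply: eq_bigr => c _; rewrite -!exprM -exprD -mulnDr mulnC.
  case: eqP => mf.
    have -> : z ^+ (h.*2 + moment f) = 1.
      by rewrite -(prim_expr_mod prim_z) -modnDmr mf modnDmr addn1 modnn expr0.
    rewrite (eq_bigr (fun=> 1)) => [|c _]; last by rewrite expr1n.
    rewrite sumr_const card_ord /p -muln2 mulrS mulrnA mulrn_pchar //.
    by rewrite addr0.
  apply: geom => //; apply/eqP => /eqP; rewrite -(prim_order_dvd prim_z) => pd.
  by apply: mf; apply/eqP; rewrite -(eqn_modDl h.*2) addn1 modnn.
have -> : \sum_(f : box | moment f == 1 %[mod p]) 'X^(norm2 f)
   = \sum_(c < p) (z ^+ (c * h.*2))%:P * theta_twisted (z ^+ c).
  under [RHS]eq_bigr => c _ do rewrite theta_twisted_sum mulr_sumr.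
  rewrite exchange_big /= big_mkcond; apply: eq_bigr => f _.
  under [RHS]eq_bigr => c _ do rewrite mulrA -rmorphM /=.
  rewrite -mulr_suml -rmorph_sum /= detect.
  by case: ifP => _; rewrite ?mul1r ?mul0r.
rewrite big_ord_recl mul0n expr0 mul1r mulrDl.
apply: eqmD; first by rewrite theta_twisted1 mul1r; exact: eqm_refl.
rewrite mulr_suml.
apply: (eqm_trans (_ : eqm N _ (\sum_(i < h.*2) (z ^+ (lift ord0 i * h.*2))%:P * euler 1 ^+ p))).
  apply: eqm_sum => c _; rewrite -mulrA; apply: eqmM; first exact: eqm_refl.
  apply: theta_twistedE; rewrite prim_root_exp_coprime // coprime_sym prime_coprime //.
  by rewrite gtnNdvd // ltnS.
rewrite -mulr_suml -rmorph_sum /=.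
suff -> : \sum_(i < h.*2) z ^+ (lift ord0 i * h.*2) = 1 by rewrite mul1r; exact: eqm_refl.
have : \sum_(c < p) (z ^+ h.*2) ^+ c = 0.
  apply: geom => //; apply/eqP => /eqP; rewrite -(prim_order_dvd prim_z).
  by move=> /dvdn_leq; have := prime_gt1 p_pr; rewrite /p; lia.
rewrite big_ord_recl expr0 addrC => /eqP; rewrite addr_eq0 oppr_pchar2 // => /eqP <-.
by apply: eq_bigr => c _; rewrite -exprM mulnC.
Qed.
End OddOrder.
End CharTwo.

(** * Partitions and their multiplicities *)

Section Multiplicities.
Variable n : nat.
Local Notation bounded_seq := (n.-bseq 'I_n.+1).
Implicit Types (s : bounded_seq) (a : {ffun 'I_n -> 'I_n.+1}).

(** [inord] changes no multiplicity, each being at most the length of [s], hence at most [n]. *)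
Definition mults s : {ffun 'I_n -> 'I_n.+1} :=
  [ffun i : 'I_n => inord (count_mem i.+1 (parts s))].

Definition weight a := (\sum_(i < n) i.+1 * a i)%N.

Lemma size_parts s : (size (parts s) <= n)%N.
Proof. by rewrite size_map size_bseq. Qed.

Lemma mem_parts s x : is_partition (parts s) -> x \in parts s -> (0 < x <= n)%N.
Proof.
case/andP=> _ s0 xs; rewrite lt0n; apply/andP; split.
  by apply: contraNneq s0 => <-.
by case/mapP: xs => i _ ->; exact: leq_ord.
Qed.

Lemma multsE s (i : 'I_n) : mults s i = count_mem i.+1 (parts s) :> nat.
Proof.
by rewrite ffunE inordK // ltnS (leq_trans (count_size _ _)) // size_parts.
Qed.

Lemma sumn_parts s : is_partition (parts s) -> sumn (parts s) = weight (mults s).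
Proof.
move=> ps; rewrite sumnE /weight.
under [RHS]eq_bigr => i _ do rewrite multsE -sum1_count big_distrr big_mkcond /=.
rewrite exchange_big /= !big_seq; apply: eq_bigr => x /(mem_parts s x ps) x_n.
have xn : (x.-1 < n)%N by lia.
rewrite (bigD1 (Ordinal xn)) //= prednK ?eqxx ?muln1; last by lia.
rewrite big1 ?addn0 // => i; rewrite -val_eqE /= => ix.
by case: eqP => // xi; case/eqP: ix; rewrite xi.
Qed.

Lemma mults_inj :
  {in [pred s | is_partition (parts s)] &, injective mults}.
Proof.
move=> s u; rewrite !inE => ps pu su.
have /inj_map inj_parts : injective (val : 'I_n.+1 -> nat) by exact: val_inj.
apply: val_inj; apply: inj_parts; rewrite -/(parts s) -/(parts u).
have geq_trans : transitive geq by move=> x y z; rewrite /= => ? /leq_trans; apply.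
have geq_anti : antisymmetric geq by move=> x y; rewrite /= andbC => /anti_leq.
have [/andP[sort_s _] /andP[sort_u _]] := (ps, pu).
apply: (sorted_eq geq_trans geq_anti sort_s sort_u).
apply/allP => x; rewrite mem_cat => x_su; apply/eqP => /=.
have x_n : (0 < x <= n)%N by case/orP: x_su; apply: mem_parts.
have xn : (x.-1 < n)%N by lia.
have xE : x = (Ordinal xn).+1 by rewrite /= prednK //; lia.
by rewrite xE -!multsE su.
Qed.

(** The list with [a i] copies of each [i.+1] is no longer than its sum [weight a], so it fits into
    an [n.-bseq]. *)
Lemma mults_surj a : (weight a <= n)%N ->
  exists2 s, is_partition (parts s) & mults s = a.
Proof.
move=> wa.
pose l := sort geq (flatten [seq nseq (a i) i.+1 | i : 'I_n]).
have count_l (i : 'I_n) : count_mem i.+1 l = a i.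
  rewrite count_sort count_flatten -map_comp sumnE big_map big_enum /= (bigD1 i) //=.
  rewrite count_nseq /= eqxx mul1n big1 ?addn0 // => j ji.
  by rewrite count_nseq /= eqSS (inj_eq val_inj) (negPf ji).
have mem_l x : x \in l -> (0 < x <= n)%N.
  rewrite mem_sort => /flattenP[_ /mapP[i _ ->]]; rewrite mem_nseq => /andP[_ /eqP ->].
  by have := ltn_ord i.
have size_l : (size l <= n)%N.
  rewrite size_sort size_flatten /shape -map_comp sumnE big_map big_enum /=.
  apply: leq_trans wa; apply: leq_sum => i _; rewrite size_nseq; nia.
have size_l' : (size [seq inord i : 'I_n.+1 | i <- l] <= n)%N by rewrite size_map.
have parts_l : parts (Bseq size_l') = l.
  rewrite /parts /= -map_comp -[RHS]map_id; apply/eq_in_map => x /mem_l x_n /=.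
  by rewrite inordK //; lia.
exists (Bseq size_l').
  rewrite parts_l /is_partition sort_sorted ?andTb; last by move=> x y; exact: leq_total.
  by apply/negP => /mem_l.
by apply/ffunP => i; apply: val_inj; rewrite /= multsE parts_l count_l.
Qed.

End Multiplicities.

(** * Generating functions of partitions *)

Section GeneratingFunction.
Variable F : fieldType.

(** Meaningful only up to degree [n]: above it the bounded sequences miss some partitions. *)
Definition partition_gf n (A : pred nat) : {poly F} :=
  \sum_(s : n.-bseq 'I_n.+1 | is_partition (parts s) && all A (parts s))
     'X^(sumn (parts s)).

(** Each [1 / (1 - q^(i + 1))] is a geometric sum over the multiplicity of the part [i.+1];
    distributing the product and passing back through [mults] recovers the partitions. *)
Lemma partition_gfE n A :
  eqm n.+1 (partition_gf n A * \prod_(i < n | A i.+1) (1 - 'X^(i.+1))) 1.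
Proof.
pose Q (i : 'I_n) (k : 'I_n.+1) := (k == 0 :> nat) || A i.+1.
have small (I : finType) (C : pred I) (e : I -> nat) :
    eqm n.+1 (\sum_(x | C x) 'X^(e x) : {poly F}) (\sum_(x | C x && (e x <= n)%N) 'X^(e x)).
  rewrite (bigID (fun x => (e x <= n)%N)) /=.
  apply: (eqm_trans (_ : eqm _ _ (_ + \sum_(x | C x && ~~ (e x <= n)%N) 0))).
    apply: eqmD; first exact: eqm_refl.
    apply: eqm_sum => x /andP[_ ex]; rewrite -['X^_]mulr1; apply: eqm_XnM; lia.
  by rewrite big1_eq addr0; exact: eqm_refl.
have -> : eqm n.+1 (partition_gf n A) (\prod_(i < n) \sum_(k < n.+1 | Q i k) 'X^(i.+1 * k)).
  rewrite bigA_distr_big_dep.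
  under [X in eqm _ _ X]eq_bigr => f _ do rewrite prodrXr.
  (* Both sums also contain monomials of degree above [n], which need not correspond under [mults];
     they are discarded first. *)
  apply: eqm_trans (small _ _ _) _; apply: eqm_trans (eqm_sym (small _ _ _)).
  pose S := [set s : n.-bseq 'I_n.+1 | is_partition (parts s) && all A (parts s)
    && (sumn (parts s) <= n)%N].
  have SE : [set a | (a \in family Q) && (weight n a <= n)%N] = @mults n @: S.
    apply/setP=> a; rewrite inE; apply/andP/imsetP => [[aQ wa]|[s]].
      have [s ps sa] := mults_surj n a wa; exists s => //.
      rewrite inE ps sumn_parts // sa wa andbT /=; apply/allP => x xs.
      have x_n := mem_parts n s x ps xs; have xn : (x.-1 < n)%N by lia.
      have : Q (Ordinal xn) (a (Ordinal xn)) by exact: (familyP aQ).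
      rewrite /Q -sa multsE /= prednK; last by lia.
      by case/orP => //; rewrite -leqn0 leqNgt -has_count; case/hasP; exists x => /=.
    rewrite inE -andbA => /and3P[ps As ws] ->; split; last by rewrite -sumn_parts.
    apply/familyP => i; rewrite -[_ \in _]/(Q i (mults n s i)) /Q multsE -leqn0 leqNgt -has_count.
    by case: hasP => //= -[x xs /eqP <-]; exact: (allP As).
  have -> : \sum_(f in family Q | (\sum_(i < n) i.+1 * f i <= n)%N) 'X^(\sum_(i < n) i.+1 * f i)
      = \sum_(a in [set a | (a \in family Q) && (weight n a <= n)%N]) 'X^(weight n a) :> {poly F}.
    by apply: eq_bigl => a; rewrite inE.
  rewrite SE big_imset /=; last first.
    move=> s u; rewrite !inE => /andP[/andP[ps _] _] /andP[/andP[pu _] _].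
    exact: (mults_inj n s u ps pu).
  set lhs := (X in eqm _ X _); set rhs := (X in eqm _ _ X).
  suff -> : lhs = rhs by exact: eqm_refl.
  by apply: eq_big => [s | s /andP[/andP[ps _] _]]; rewrite ?inE // sumn_parts.
rewrite [X in _ * X]big_mkcond -big_split /=.
apply: (eqm_trans (_ : eqm _ _ (\prod_(i < n) 1))); last by rewrite big1 //; exact: eqm_refl.
apply: eqm_prod => i _; rewrite /Q; case: ifP => Ai; last first.
  rewrite mulr1 (bigD1 ord0) //= muln0 expr0 big1 ?addr0; first exact: eqm_refl.
  by move=> k; rewrite orbF => /andP[/eqP k0]; rewrite -val_eqE /= k0.
under eq_bigl => k do rewrite orbT.
under eq_bigr => k _ do rewrite exprM.
have -> : (\sum_(k < n.+1) 'X^(i.+1) ^+ k) * (1 - 'X^(i.+1)) = 1 - 'X^(i.+1) ^+ n.+1 :> {poly F}.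
  by rewrite -[RHS]opprB subrX1 -mulNr opprB mulrC.
rewrite /eqm addrAC subrr add0r dvdpNr -exprM dvdp_exp2l //; nia.
Qed.

Lemma coef_partition_gf n A k : (partition_gf n A)`_k
  = #|[set s : n.-bseq 'I_n.+1 | [&& is_partition (parts s), sumn (parts s) == k
        & all A (parts s)]]|%:R.
Proof.
rewrite coef_sum -sum1_card natr_sum big_mkcond [RHS]big_mkcond /=.
apply: eq_bigr => s _; rewrite inE coefXn eq_sym andbA andbAC.
by case: (_ && all _ _) => //=; case: eqP.
Qed.

Lemma regular_partitions_coef m n :
  (regular_partitions m n)%:R = (partition_gf n (fun k => ~~ (m %| k)%N))`_n.
Proof. by rewrite coef_partition_gf. Qed.

Lemma multipartitions_coef t n :
  (multipartitions t n)%:R = (partition_gf n predT ^+ t)`_n.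
Proof.
rewrite -[t in _ ^+ t]card_ord -prodr_const /partition_gf bigA_distr_big.
under eq_bigr => f _ do rewrite prodrXr.
rewrite coef_sum /multipartitions -sum1_card natr_sum.
rewrite (reindex (@finfun_of_tuple _ t)) /=; last first.
  exists (@tuple_of_finfun _ t) => x _; [exact: finfun_of_tupleK | exact: tuple_of_finfunK].
rewrite big_mkcond [RHS]big_mkcond /=; apply: eq_bigr => P _; rewrite inE coefXn.
have -> : (finfun_of_tuple P \in ffun_on
   [pred s | is_partition (parts s) && all predT (parts s)])
   = all (fun s => is_partition (parts s)) P.
  apply/ffun_onP/all_tnthP => H i; have := H i; rewrite inE ffunE all_predT andbT //.
have -> : (\sum_(i < t) sumn (parts (finfun_of_tuple P i)) = \sum_(s <- P) sumn (parts s))%N.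
  by rewrite big_tuple; apply: eq_bigr => i _; rewrite ffunE.
by rewrite eq_sym; case: all => //=; case: eqP.
Qed.

Hypothesis F2 : 2%N \in [pchar F].

Lemma euler1_trunc n N : (n <= N)%N ->
  eqm n.+1 (euler F N 1) (\prod_(i < n) (1 + 'X^(i.+1))).
Proof.
move=> nN; rewrite [X in eqm _ _ X](eq_bigr (fun i : 'I_n => 1 + 'X^(1 * i.+1))).
  apply: (prod_trunc _ n.+1 n N (fun i => 1 + 'X^(1 * i.+1))) => // i ni.
  by rewrite mul1n /eqm addrAC subrr add0r dvdp_exp2l.
by move=> i _; rewrite mul1n.
Qed.

(** The factors of [f_1] with exponent not divisible by [m] cancel the generating function; the
    remaining ones make up [f_m]. *)
Lemma regular_partitions_gf m n N : (0 < m)%N -> (n <= N)%N ->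
  eqm n.+1 (partition_gf n (fun k => ~~ (m %| k)%N) * euler F N 1) (euler F N m).
Proof.
move=> m0 nN.
pose g i : {poly F} := if (m %| i.+1)%N then 1 + 'X^(i.+1) else 1.
have trunc i : (n <= i)%N -> eqm n.+1 (1 + 'X^(i.+1) : {poly F}) 1.
  by move=> ni; rewrite /eqm addrAC subrr add0r dvdp_exp2l.
rewrite (euler1_trunc n N nN).
have -> : eqm n.+1 (euler F N m) (\prod_(i < n) g i).
  have -> : euler F N m = \prod_(i < N * m) g i.
    rewrite prod_regroup; apply: eq_bigr => k _.
    case: m m0 @g => // m' _ g; rewrite big_ord_recr /= big1 ?mul1r.
      rewrite /g -addnS -mulSnr dvdn_mull //; congr (1 + 'X^_); lia.
    move=> r _; rewrite /g -addnS dvdn_addr ?dvdn_mull // gtnNdvd // ltnS //.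
  apply: prod_trunc => [|i ni]; first by nia.
  by rewrite /g; case: ifP => _; [exact: trunc | exact: eqm_refl].
rewrite [X in eqm _ (_ * X)](bigID (fun i : 'I_n => ~~ (m %| i.+1)%N)) /= mulrA.
have -> : \prod_(i < n | ~~ ~~ (m %| i.+1)%N) (1 + 'X^(i.+1)) = \prod_(i < n) g i.
  by rewrite big_mkcond; apply: eq_bigr => i _; rewrite negbK.
rewrite (eq_bigr (fun i : 'I_n => 1 - 'X^(i.+1))) => [|i _]; last by rewrite oppr_pchar2 // pchar_poly.
by rewrite partition_gfE mul1r; exact: eqm_refl.
Qed.

Lemma multipartitions_gf t n N : (n <= N)%N ->
  eqm n.+1 (partition_gf n predT ^+ t * euler F N 1 ^+ t) 1.
Proof.
move=> nN; rewrite -exprMn -[X in eqm _ _ X](expr1n _ t); apply: eqm_exp.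
rewrite (euler1_trunc n N nN) (eq_bigr (fun i : 'I_n => 1 - 'X^(i.+1))).
  exact: (partition_gfE n predT).
by move=> i _; rewrite oppr_pchar2 // pchar_poly.
Qed.
End GeneratingFunction.

(** * The isometry between the two lattice counts *)

Lemma tri_subz k m : (tri k m)%:Z - (tri m k)%:Z = k%:Z - m%:Z.
Proof.
have binS2 (c : nat) : 'C(c.+1, 2) = (c + 'C(c, 2))%N by rewrite binS bin1 addnC.
by rewrite /tri !binS2; lia.
Qed.

Lemma tri_addz k m : (tri k m)%:Z + (tri m k)%:Z = (k%:Z - m%:Z) ^+ 2.
Proof.
rewrite -PoszD tri_sum -!mulnn; have [mk|km] := leqP m k; nia.
Qed.

Section Isometry.
Variables (h N K b : nat) (O : 'M[int]_h).
Let p := h.*2.+1.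
Hypothesis p_prime : prime p.
Hypothesis O_sym : O^T = O.
Hypothesis O_sqr : O *m O = (p%:Z ^+ 2)%:M.
Hypothesis O_mod : forall r i, O r i - r.+1%:Z * i.+1%:Z \in dvdz p%:Z.
Hypothesis sum_squares : (\sum_(i < h) i.+1 ^ 2 = p * b)%N.
Hypothesis K_small : (p * K <= N)%N.

Local Notation row := 'rV[int]_h.
Implicit Types x y : row.

Let p0 : p%:Z != 0. Proof. by []. Qed.

Definition nsq x : int := \sum_(i < h) x 0 i ^+ 2.
Definition rho : row := \row_i i.+1%:Z.
Definition lin x : int := \sum_(i < h) i.+1%:Z * x 0 i.

Definition shift x : row := p%:Z *: x + rho.
Definition unshift x : row := \row_i ((x 0%R i - i.+1%:Z) %/ p%:Z)%Z.

Lemma shiftK : cancel shift unshift.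
Proof. by move=> x; apply/rowP => i; rewrite !mxE addrK mulKz. Qed.

Lemma nsq_mulO x : nsq (x *m O) = p%:Z ^+ 2 * nsq x.
Proof.
have nsqE y : nsq y = (y *m y^T) 0 0.
  by rewrite mxE; apply: eq_bigr => i _; rewrite mxE expr2.
rewrite !nsqE trmx_mul O_sym mulmxA -(mulmxA x) O_sqr mul_mx_scalar.
by rewrite -scalemxAl mxE.
Qed.

Lemma mulO_mod x i : (x *m O) 0 i - i.+1%:Z * lin x \in dvdz p%:Z.
Proof.
rewrite mxE /lin mulr_sumr -sumrB; apply: rpred_sum => r _.
rewrite (_ : _ - _ = x 0 r * (O r i - r.+1%:Z * i.+1%:Z)); last by ring.
by rewrite dvdz_mull.
Qed.

Lemma nsq_shift x :
  nsq (shift x) = p%:Z * (p%:Z * nsq x + 2 * lin x + b%:Z).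
Proof.
rewrite /nsq /lin; under eq_bigr => i _ do rewrite !mxE.
have -> : p%:Z * (p%:Z * (\sum_(i < h) x 0 i ^+ 2) + 2 * (\sum_(i < h) i.+1%:Z * x 0 i) + b%:Z)
    = \sum_(i < h) (p%:Z ^+ 2 * x 0 i ^+ 2 + 2 * p%:Z * (i.+1%:Z * x 0 i))
      + (p * b)%N%:Z.
  by rewrite big_split /= -!mulr_sumr PoszM; ring.
rewrite -sum_squares (big_morph Posz PoszD (erefl _)) -big_split /=; apply: eq_bigr => i _.
by rewrite -mulnn PoszM; ring.
Qed.

(* The vector [r.+1 * v - O_r] lies in [p Z^h], and the squared lengths of [v]
   and of the row [O_r] are divisible by [p^2]; expand its squared length. *)
Lemma dvd_mulO (v : row) : (forall i, v 0 i - i.+1%:Z \in dvdz p%:Z) -> nsq v \in dvdz (p%:Z ^+ 2) ->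
  forall r, (v *m O) 0 r \in dvdz (p%:Z ^+ 2).
Proof.
move=> v_mod v_nsq r.
have r_h := ltn_ord r.
have O_rc i j : O i j = O j i by rewrite -{1}O_sym mxE.
(* [p = 2 h + 1] divides neither 2 nor [r.+1 <= h], so the factor [2 * r.+1] can be cancelled. *)
have cop : coprimez (p%:Z ^+ 2) (2 * r.+1%:Z).
  rewrite coprimezE abszX coprimeXl // abszM prime_coprime //.
  rewrite Euclid_dvdM // !gtnNdvd //= /p; lia.
rewrite -(Gauss_dvdzr _ cop).
have E : \sum_(i < h) (r.+1%:Z * v 0 i - O r i) ^+ 2
    = r.+1%:Z ^+ 2 * nsq v - 2 * r.+1%:Z * (v *m O) 0 r + p%:Z ^+ 2.
  have -> : p%:Z ^+ 2 = \sum_(i < h) O r i ^+ 2.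
    transitivity ((O *m O) r r); first by rewrite O_sqr mxE eqxx mulr1n.
    rewrite mxE; apply: eq_bigr => i _.
    by rewrite [O i r]O_rc expr2.
  rewrite mxE /nsq !mulr_sumr -sumrN -!big_split /=; apply: eq_bigr => i _.
  by rewrite [O i r]O_rc; ring.
have -> : 2 * r.+1%:Z * (v *m O) 0 r = r.+1%:Z ^+ 2 * nsq v + p%:Z ^+ 2
    - \sum_(i < h) (r.+1%:Z * v 0 i - O r i) ^+ 2 by rewrite E; ring.
apply: rpredB; first by apply: rpredD; [exact: dvdz_mull | exact: dvdzz].
apply: rpred_sum => i _; apply: dvdz_exp2r.
rewrite (_ : _ - _ = r.+1%:Z * (v 0 i - i.+1%:Z) - (O r i - r.+1%:Z * i.+1%:Z)).
  by rewrite rpredB // dvdz_mull.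
by ring.
Qed.

Definition to_shifted x : row := unshift (x *m O).
Definition of_shifted y : row := \row_r ((shift y *m O)%R 0%R r %/ p%:Z ^+ 2)%Z.

Definition centred x := (nsq x == K%:Z) && (lin x - 1 \in dvdz p%:Z).
(** By [nsq_shift] the condition says that [shift y] has squared length [p^2 K]. *)
Definition shifted y := p%:Z * nsq y + 2 * lin y + b%:Z == (p * K)%N%:Z.

Lemma shift_to_shifted x : centred x -> shift (to_shifted x) = x *m O.
Proof.
case/andP=> _ lin_x; apply/rowP => i; rewrite !mxE mulrC divzK; first by rewrite subrK.
have := mulO_mod x i; rewrite mxE; set v := \sum_j _ => v_mod.
rewrite (_ : v - _ = (v - i.+1%:Z * lin x) + i.+1%:Z * (lin x - 1)); last by ring.
by rewrite rpredD // dvdz_mull.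
Qed.

Lemma to_shiftedP x : centred x -> shifted (to_shifted x).
Proof.
move=> cx; rewrite /shifted -(inj_eq (mulfI p0)) -nsq_shift shift_to_shifted //.
by rewrite nsq_mulO (eqP (proj1 (andP cx))) PoszM expr2 mulrA.
Qed.

Lemma to_shiftedK x : centred x -> of_shifted (to_shifted x) = x.
Proof.
move=> cx; apply/rowP => r; rewrite mxE shift_to_shifted // -mulmxA O_sqr.
by rewrite mul_mx_scalar mxE mulKz // expf_neq0.
Qed.

Lemma nsq_shifted y : shifted y -> nsq (shift y) = p%:Z ^+ 2 * K%:Z.
Proof. by move=> /eqP sy; rewrite nsq_shift sy PoszM expr2 mulrA. Qed.

Lemma of_shifted_mul y : shifted y -> p%:Z ^+ 2 *: of_shifted y = shift y *m O.
Proof.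
move=> sy; apply/rowP => r; rewrite [LHS]mxE [X in _ * X]mxE mulrC divzK //.
apply: dvd_mulO => [i|]; first by rewrite !mxE addrK dvdz_mulr.
by rewrite nsq_shifted // dvdz_mulr.
Qed.

Lemma of_shifted_mulO y : shifted y -> of_shifted y *m O = shift y.
Proof.
move=> sy.
have : p%:Z ^+ 2 *: (of_shifted y *m O) = p%:Z ^+ 2 *: shift y.
  by rewrite scalemxAl of_shifted_mul // -mulmxA O_sqr mul_mx_scalar.
move/rowP => E; apply/rowP => i; apply: (mulfI (expf_neq0 2 p0)).
by have := E i; rewrite mxE [RHS]mxE.
Qed.

Lemma of_shiftedP y : shifted y -> centred (of_shifted y).
Proof.
move=> sy; apply/andP; split.
  rewrite -(inj_eq (mulfI (expf_neq0 2 p0))) -nsq_mulO of_shifted_mulO //.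
  by rewrite nsq_shifted.
(* The first coordinate of [shift y] is 1 modulo [p], and [mulO_mod] identifies it with
   [lin (of_shifted y)] modulo [p]. *)
have h0 : (0 < h)%N by have := prime_gt1 p_prime; rewrite /p; lia.
have := mulO_mod (of_shifted y) (Ordinal h0).
rewrite of_shifted_mulO // !mxE /= mul1r => y_mod.
rewrite (_ : _ - 1 = p%:Z * y 0 (Ordinal h0) - (p%:Z * y 0 (Ordinal h0) + 1 - lin (of_shifted y))).
  by rewrite rpredB // dvdz_mulr.
by ring.
Qed.

Lemma of_shiftedK y : shifted y -> to_shifted (of_shifted y) = y.
Proof. by move=> sy; rewrite /to_shifted of_shifted_mulO // shiftK. Qed.

Lemma nsq_bound x i c : nsq x <= c%:Z -> (c <= N)%N -> `|x 0 i| <= N%:Z.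
Proof.
move=> xc cN.
have : x 0 i ^+ 2 <= c%:Z.
  apply: le_trans xc; rewrite /nsq (bigD1 i) //= lerDl sumr_ge0 // => j _; exact: sqr_ge0.
by rewrite expr2; nia.
Qed.

Lemma centred_bound x i : centred x -> `|x 0 i| <= N%:Z.
Proof.
case/andP=> /eqP xK _; apply: (nsq_bound _ _ K); first by rewrite xK.
by apply: leq_trans K_small; rewrite leq_pmull.
Qed.

(** Since [c^2 + c >= 0] for every integer [c] and [j + 1 <= h], the form [p |x|^2 + 2 lin x] is at
    least [|x|^2]; hence [|x|^2 <= p K <= N], and the box contains every solution. *)
Lemma shifted_bound x i : shifted x -> `|x 0 i| <= N%:Z.
Proof.
move/eqP => sx; apply: (nsq_bound _ _ (p * K)) => //.
have : p%:Z * nsq x + 2 * lin x >= nsq x.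
  rewrite /nsq /lin !mulr_sumr -big_split /=; apply: ler_sum => j _.
  have j_h := ltn_ord j; set c := x 0 j.
  have sq_c : 0 <= c * c + c by have [|] := lerP 0 c; nia.
  have : 0 <= (h%:Z - j.+1%:Z) * (c * c) + j.+1%:Z * (c * c + c).
    by rewrite addr_ge0 // mulr_ge0 // ?subr_ge0 // -expr2 sqr_ge0.
  have -> : p%:Z = 2 * h%:Z + 1 by rewrite /p; lia.
  rewrite -subr_ge0 expr2 => c_ge0; rewrite (_ : _ - _ = 2 * ((h%:Z - j.+1%:Z) * (c * c) + j.+1%:Z * (c * c + c))).
    by rewrite mulr_ge0.
  by ring.
by move=> le_x; apply: le_trans le_x _; rewrite -sx lerDl.
Qed.

Local Notation box := (box N h).

Definition coords (f : box) : row := \row_i ((f i)%:Z - N%:Z).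
Definition of_coords x : box := [ffun i => inord (absz (x 0 i + N%:Z))].

Lemma coordsK : cancel coords of_coords.
Proof.
move=> f; apply/ffunP => i; rewrite ffunE !mxE subrK absz_nat.
by apply: val_inj; rewrite /= inordK.
Qed.

Lemma of_coordsK x : (forall i, `|x 0 i| <= N%:Z) -> coords (of_coords x) = x.
Proof.
move=> xN; apply/rowP => i; rewrite mxE ffunE.
move: (xN i); rewrite ler_norml => /andP[x_ge x_le].
have x0 : 0 <= x 0 i + N%:Z by rewrite -lerBlDr sub0r.
have x_abs : (absz (x 0 i + N%:Z))%:Z = x 0 i + N%:Z by rewrite gez0_abs.
by rewrite inordK -?ltz_nat x_abs; lia.
Qed.

(** The exponent belonging to [f] in the expanded product of the [theta_shifted]. *)
Definition shifted_norm2 (f : box) :=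
  (\sum_(i < h) ((p + i.+1.*2) * tri (f i) N + (p - i.+1.*2) * tri N (f i)))%N.

Lemma norm2_coords f : (norm2 N h f)%:Z = nsq (coords f).
Proof.
rewrite /norm2 (big_morph Posz PoszD (erefl _)); apply: eq_bigr => i _.
by rewrite mxE PoszD tri_addz.
Qed.

Lemma shifted_norm2_coords f :
  (shifted_norm2 f)%:Z = p%:Z * nsq (coords f) + 2 * lin (coords f).
Proof.
rewrite /shifted_norm2 (big_morph Posz PoszD (erefl _)) /nsq /lin !mulr_sumr -big_split /=.
apply: eq_bigr => i _; rewrite mxE -tri_addz -tri_subz.
have ip : (i.+1.*2 <= p)%N by have := ltn_ord i; rewrite /p; lia.
rewrite PoszD !PoszM (_ : (p + i.+1.*2)%N%:Z = p%:Z + 2 * i.+1%:Z); last by lia.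
by rewrite (_ : (p - i.+1.*2)%N%:Z = p%:Z - 2 * i.+1%:Z); [ring | lia].
Qed.

Lemma moment_coords f : (moment N h f == 1 %[mod p]) = (lin (coords f) - 1 \in dvdz p%:Z).
Proof.
have pE : p%:Z = (h.*2)%:Z + 1 by rewrite /p; lia.
have E : (moment N h f)%:Z = lin (coords f)
    + p%:Z * (\sum_(i < h) i.+1 * tri N (f i))%N%:Z.
  rewrite /moment /lin !(big_morph Posz PoszD (erefl _)) mulr_sumr -big_split /=.
  apply: eq_bigr => i _; rewrite mxE -tri_subz pE !PoszM PoszD PoszM; ring.
have -> : lin (coords f) = (moment N h f)%:Z
    - p%:Z * (\sum_(i < h) i.+1 * tri N (f i))%N%:Z by rewrite E addrK.
rewrite addrAC rpredBr ?dvdz_mulr //.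
by rewrite -eqz_mod_dvd !modz_nat.
Qed.

(** [to_shifted] sends [x] to [(x O - rho) / p], and [of_shifted] sends [y] to
    [(p y + rho) O / p^2]; they are mutually inverse on the solutions, and the bounds keep both
    inside the box. *)
Lemma card_shifted :
  #|[set f : box | shifted_norm2 f + b == p * K]|%N
  = #|[set f : box | (norm2 N h f == K) && (moment N h f == 1 %[mod p])]|.
Proof.
set C := [set f | _]; set D := [set f | _].
have CE f : (f \in C) = shifted (coords f).
  by rewrite inE /shifted -shifted_norm2_coords.
have DE f : (f \in D) = centred (coords f).
  by rewrite inE /centred -norm2_coords -moment_coords.
pose phi f := of_coords (to_shifted (coords f)).
pose psi f := of_coords (of_shifted (coords f)).
have phiE f : f \in D -> coords (phi f) = to_shifted (coords f).
  by rewrite DE => cf; apply: of_coordsK => i; apply: shifted_bound; exact: to_shiftedP.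
have psiE f : f \in C -> coords (psi f) = of_shifted (coords f).
  by rewrite CE => cf; apply: of_coordsK => i; apply: centred_bound; exact: of_shiftedP.
have phiK : {in D, cancel phi psi}.
  move=> f fD; rewrite /psi phiE // to_shiftedK ?coordsK //; by rewrite -DE.
have psiK : {in C, cancel psi phi}.
  move=> f fC; rewrite /phi psiE // of_shiftedK ?coordsK //; by rewrite -CE.
rewrite -(card_in_imset (can_in_inj phiK)); apply: eq_card => f.
apply/idP/imsetP => [fC|[g gD ->]].
  exists (psi f); last by rewrite psiK.
  by rewrite DE psiE // of_shiftedP // -CE.
by rewrite CE phiE // to_shiftedP // -DE.
Qed.
End Isometry.

(** * Extraction of the exponents divisible by [p] *)

Section Dissection.
Variables (R : comNzRingType) (p : nat).
Hypothesis p_gt0 : (0 < p)%N.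
Implicit Types P Q : {poly R}.

Definition multisection P : {poly R} := \poly_(k < (size P).+1) P`_(p * k).

Lemma coef_multisection P k : (multisection P)`_k = P`_(p * k).
Proof.
rewrite coef_poly; case: ltnP => // Pk; rewrite nth_default //.
by apply: leq_trans (ltnW Pk) _; rewrite leq_pmull.
Qed.

(** A factor ['X^(p * i)] moves the extracted coefficients by exactly [i] places. *)
Lemma multisectionM P Q : multisection (P * (Q \Po 'X^p)) = multisection P * Q.
Proof.
apply/polyP => k; rewrite coef_multisection comp_polyE -[in RHS](coefK Q) poly_def.
rewrite !mulr_sumr !coef_sum; apply: eq_bigr => i _.
rewrite -!scalerAr !coefZ -exprM !coefMXn coef_multisection ltn_pmul2l //.
by case: ifP => // _; rewrite -mulnBr.
Qed.
End Dissection.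

Lemma coef0_exp (R : comNzRingType) (P : {poly R}) k : (P ^+ k)`_0 = P`_0 ^+ k.
Proof. by rewrite -!horner_coef0 horner_exp. Qed.

(** * The congruence for one value of [K] *)

Section RegularPartitions.
Variables (F : fieldType) (h j b K : nat) (z : F) (O : 'M[int]_h).
Let p := h.*2.+1.
Hypothesis F2 : 2%N \in [pchar F].
Hypothesis p_prime : prime p.
Hypothesis prim_z : p.-primitive_root z.
Hypothesis O_sym : O^T = O.
Hypothesis O_sqr : O *m O = (p%:Z ^+ 2)%:M.
Hypothesis O_mod : forall r i, O r i - r.+1%:Z * i.+1%:Z \in dvdz p%:Z.
Hypothesis sum_squares : (\sum_(i < h) i.+1 ^ 2 = p * b)%N.
Hypothesis b_small : (b <= p * K)%N.
Hypothesis j_small : (2 ^ j < p)%N.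
Hypothesis K_res : forall r, (r < p)%N ->
  2 * K != 2 ^ j * (r * (3 * r + 1)) %[mod p].

Let N := (p * K).+1.
Let R := (p * K - b)%N.
Let euler := euler F N.

Definition theta_residue : {poly F} :=
  \sum_(f : box N h | moment N h f == 1 %[mod p]) 'X^(norm2 N h f).

(** The factor ['X^b] completes the square: the exponents become [|p x + rho|^2 / p], and those
    equal to [p k] are counted by [card_shifted]. *)
Lemma multisection_theta_shifted :
  eqm K.+1 (multisection F p ('X^b * \prod_(i < h) theta_shifted F N h i)) theta_residue.
Proof.
apply/eqmP => k kK; rewrite coef_multisection // coefXnM.
have -> : \prod_(i < h) theta_shifted F N h i = \sum_(f : box N h) 'X^(shifted_norm2 h N f).
  rewrite /theta_shifted bigA_distr_bigA; apply: eq_bigr => f _.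
  by rewrite /shifted_norm2 -prodrXr; apply: eq_bigr => i _; rewrite -!exprM -exprD.
rewrite /theta_residue !coef_sum.
transitivity (#|[set f : box N h | shifted_norm2 h N f + b == p * k]|%N%:R : F).
  rewrite -sum1_card natr_sum [RHS]big_mkcond /=; case: ltnP => pkb.
    rewrite big1 // => f _; rewrite inE; case: eqP => //; lia.
  apply: eq_bigr => f _; rewrite inE coefXn.
  rewrite (_ : (_ == _) = (shifted_norm2 h N f + b == p * k)%N); first by case: eqP.
  by apply/eqP/eqP; lia.
rewrite (card_shifted h N k b O) //; last by rewrite /N; nia.
rewrite -sum1_card natr_sum big_mkcond [RHS]big_mkcond /=; apply: eq_bigr => f _.
by rewrite inE coefXn andbC (eq_sym k); case: (_ == _ %[mod _]) => //=; case: eqP.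
Qed.

Lemma regular_multipartitions :
  (regular_partitions (2 ^ j * p) (p * K - b))%:R
    = (multipartitions (p - 2 ^ j) K)%:R :> F.
Proof.
set t := (p - 2 ^ j)%N; rewrite regular_partitions_coef multipartitions_coef -/R.
set GR := partition_gf _ R _; set GP := partition_gf _ K _ ^+ t.
have tE : (t + 2 ^ j = p)%N by rewrite /t; lia.
have RN : (R.+1 <= N)%N by rewrite /R /N ltnS leq_subr.
have KN : (K.+1 <= N)%N by rewrite /N ltnS leq_pmull.
have p_gt0 : (0 < p)%N by [].
have euler0 k e : (0 < k)%N -> (euler k ^+ e)`_0 != 0.
  by move=> k0; rewrite coef0_exp expf_neq0 // euler_coef0.
(* As [GR = f_p^(2^j) / f_1], the left side is [f_p^p / f_1]. *)
have GR_PT : eqm R.+1 (GR * euler p ^+ t) (\prod_(i < h) theta_shifted F N h i).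
  apply: (eqm_mulI (euler0 p (2 ^ j)%N p_gt0)).
  rewrite mulrCA -exprD addnC tE.
  have E1 := eqm_leq RN (prod_theta_shifted F F2 N h).
  apply: eqm_trans (eqmM eqm_refl (eqm_sym E1)) _; rewrite mulrA; apply: eqmM; last exact: eqm_refl.
  rewrite -euler_pow2 //; apply: regular_partitions_gf => //; first by rewrite muln_gt0 expn_gt0.
  exact: ltnW.
have U_GR : eqm K.+1 (multisection F p ('X^b * GR) * euler 1 ^+ t) theta_residue.
  rewrite -multisectionM // rmorphXn /= -euler_comp -mulrA.
  apply: eqm_trans _ multisection_theta_shifted.
  apply/eqmP => k kK; rewrite !coef_multisection // !coefXnM; case: ifP => // pkb.
  move/eqmP: GR_PT; apply; rewrite /R; nia.
have GP1 : eqm K.+1 (GP * euler 1 ^+ t) 1 by apply: multipartitions_gf => //; exact: ltnW.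
have theta_p : eqm K.+1 (theta_residue * euler p) (euler p + euler 1 ^+ p).
  by apply: eqm_leq KN _; exact: (sum_box_moment1 F F2 N h z).
(* In characteristic 2 this sum is the difference of the two series. *)
set D := multisection F p ('X^b * GR) + GP.
(* After multiplication by [f_1^t] the left side is [(theta_residue + 1) f_p = f_1^p], and
   [p - t = 2^j]. *)
have D_euler : eqm K.+1 (D * euler p) (euler (2 ^ j)).
  apply: (eqm_mulI (euler0 1%N t isT)).
  have -> : euler (2 ^ j) = euler 1 ^+ (2 ^ j) by rewrite /euler -euler_pow2 // muln1.
  rewrite -exprD tE mulrA [_ * D]mulrC.
  rewrite mulrDl U_GR GP1 mulrDl theta_p mul1r addrC addrA addrr_pchar2 ?pchar_poly // add0r.
  exact: eqm_refl.
(* [1 / f_p = euler_odd p] is a polynomial in ['X^p], so up to degree [K] the exponents of [D] are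
   congruent modulo [p] to exponents of [f_(2^j)]. *)
have D_odd : eqm K.+1 D (euler (2 ^ j) * euler_odd F N p).
  rewrite -D_euler -mulrA [_ * euler_odd _ _ _]mulrC.
  have -> : eqm K.+1 (euler_odd F N p * euler p) 1.
    by apply: eqm_leq KN _; exact: euler_odd_inv.
  by rewrite mulr1; exact: eqm_refl.
have odd_comp : euler_odd F N p = euler_odd F N 1 \Po 'X^p.
  rewrite /euler_odd rmorph_prod; apply: eq_bigr => i _ /=.
  by rewrite rmorphD /= comp_polyC rmorphXn /= comp_polyX mul1n exprM.
have DK : D`_K = 0.
  have pent := eqm_leq KN (euler_pentagonal F F2 N (2 ^ j) (expn_gt0 2 j)).
  have /eqmP/(_ K (ltnSn K)) -> := eqm_trans D_odd (eqmM pent eqm_refl).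
  rewrite mulr_suml coef_sum big1 // => i _; rewrite coefXnM; case: ltnP => // eK.
  rewrite odd_comp coef_comp_poly_Xn //; case: ifP => // pd; exfalso.
  pose n := (i : nat)%:Z - N%:Z; pose r := absz (modz n p%:Z).
  have rE : r%:Z = modz n p%:Z by rewrite gez0_abs // modz_ge0.
  have rp : (r < p)%N by rewrite -ltz_nat rE ltz_pmod.
  case/negP: (K_res r rp); apply/eqP/eqP; rewrite -eqz_nat -!modz_nat eqz_mod_dvd.
  set e := (2 ^ j * _)%N in eK pd.
  have eE : 2 * e%:Z = (2 ^ j)%N%:Z * (n * (3 * n + 1)).
    rewrite /e PoszM PoszD PoszM.
    transitivity ((2 ^ j)%N%:Z * (3 * ((tri i N)%:Z + (tri N i)%:Z) + ((tri i N)%:Z - (tri N i)%:Z))).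
      by ring.
    by rewrite tri_addz tri_subz -/n; ring.
  (* This uses [n (3 n + 1) - r (3 r + 1) = (n - r) (3 (n + r) + 1)]. *)
  have -> : (2 * K)%N%:Z - (2 ^ j * (r * (3 * r + 1)))%N%:Z
      = 2 * (K - e)%N%:Z + (2 ^ j)%N%:Z * (n - r%:Z) * (3 * (n + r%:Z) + 1).
    rewrite -(subzn eK) !PoszM PoszD PoszM mulrBr eE; ring.
  apply: rpredD; first by apply: dvdz_mull; exact: pd.
  by apply/dvdz_mulr/dvdz_mull; rewrite rE {1}(divz_eq n p%:Z) addrK dvdz_mull.
have : (multisection F p ('X^b * GR))`_K = GP`_K.
  by apply/eqP; rewrite -subr_eq0 oppr_pchar2 // -coefD -/D DK.
rewrite coef_multisection // coefXnM ltnNge b_small /= => <-.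
by [].
Qed.
End RegularPartitions.

(** * A field with roots of unity, and the finite verifications *)

Lemma natr_eq_mod2 (F : fieldType) (a b : nat) : 2%N \in [pchar F] ->
  a%:R = b%:R :> F -> a = b %[mod 2].
Proof.
move=> F2 ab; have := ab; rewrite -(GRing.natr_mod_pchar F2 a) -(GRing.natr_mod_pchar F2 b) !modn2.
by case: odd; case: odd => //= /eqP; rewrite ?[0 == _]eq_sym oner_eq0.
Qed.

(** By Fermat [p] divides [2^(p - 1) - 1], the order of the unit group of the field with [2^(p - 1)]
    elements, and Cauchy's theorem gives an element of order [p] there. *)
Lemma char2_prim_root p : prime p -> odd p ->
  exists (F : fieldType) (z : F), 2%N \in [pchar F] /\ p.-primitive_root z.
Proof.
move=> p_pr p_odd; have p1 := prime_gt1 p_pr.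
have [F F2 cardF] := pPrimePowerField (p := 2) (k := p.-1) isT (ltac:(lia)).
have p_dvd : (p %| #|[set: {unit F}]|)%N.
  rewrite card_finField_unit cardF -subn1 -eqn_mod_dvd ?expn_gt0 //.
  by rewrite -(totient_prime p_pr) Euler_exp_totient // coprime2n.
have [x _ ox] := Cauchy p_pr p_dvd.
have xp : FinRing.uval x ^+ p = 1 by rewrite -FinRing.val_unitX -ox expg_order.
exists F, (FinRing.uval x); split=> //.
have [m prim_m mp] := prim_order_exists (ltnW p1) xp.
case/primeP: p_pr => _ /(_ m mp) /orP[/eqP m1|/eqP <- //].
have x1 : x = 1%g.
  by apply: val_inj; have := prim_expr_order prim_m; rewrite m1 expr1.
by move: p1; rewrite -ox x1 order1.
Qed.

(** On the lower half of the residues [fs] chooses between [r] and [r - p]; the upper half is filled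
    by oddness. For prime [p], each row of the matrix of values at [r * i] is then the first row up
    to order and signs, so all rows have the same length. *)
Definition signed_residue p (fs : seq nat) k : int :=
  let r := (k %% p)%N in
  if (r <= p./2)%N then r%:Z - (if r \in fs then p else 0%N)%:Z
  else (if (p - r)%N \in fs then p else 0%N)%:Z - (p - r)%N%:Z.

(* For each [p] the numbers [i <= p./2], replaced by [i - p] when [i] is listed
   here, form a vector of squared length [p ^ 2]. *)
Definition flips p : seq nat :=
  nth [::] [:: [:: 1; 2]; [:: 1]; [:: 3; 5]; [:: 4; 6]; [:: 6]; [:: 8; 9]; [:: 11]]%N
    (index p [:: 5; 7; 11; 13; 17; 19; 23]%N).

(** [foldr] and [iota] replace big operators, which do not evaluate under [vm_compute]. *)
Definition orthogonal_mod p : bool :=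
  let w k := signed_residue p (flips p) k in
  all (fun r => all (fun i =>
      foldr (fun k x => w (r * k)%N * w (k * i)%N + x) 0 (iota 1 p./2)
        == (if r == i then p%:Z ^+ 2 else 0)) (iota 1 p./2)) (iota 1 p./2).

(** [s] and [p] recover [2^j] and [m0] from [m]. The bound [beta p <= p] together with [0 < B] rules
    out truncation in [p * (p * n + B) - beta p]. *)
Definition admissible (c : nat * seq nat) : bool :=
  let s := (2 ^ logn 2 c.1)%N in let p := (c.1 %/ s)%N in
  [&& prime p, orthogonal_mod p, (s < p)%N, (beta p <= p)%N,
      foldr (fun i x => i ^ 2 + x)%N 0%N (iota 1 p./2) == (p * beta p)%N
    & all (fun B => (0 < B)%N &&
        all (fun r => 2 * B != s * (r * (3 * r + 1)) %[mod p]) (iota 0 p)) c.2].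

Lemma congruence_cases_admissible : all admissible congruence_cases.
Proof. by vm_compute. Qed.

Lemma signed_residue_mod p fs k : (0 < p)%N ->
  signed_residue p fs k - k%:Z \in dvdz p%:Z.
Proof.
move=> p0; rewrite /signed_residue; set r := (k %% p)%N.
have rp : (r < p)%N by rewrite ltn_mod.
have -> : k%:Z = (k %/ p)%N%:Z * p%:Z + r%:Z by rewrite -PoszM -PoszD -divn_eq.
have if_mod (c : bool) : (if c then p else 0%N)%:Z \in dvdz p%:Z by case: c; rewrite ?dvdzz ?dvdz0.
case: ifP => _.
  rewrite (_ : _ - _ = - ((if r \in fs then p else 0%N)%:Z + (k %/ p)%N%:Z * p%:Z)); last by ring.
  by rewrite rpredN rpredD // dvdz_mull.
rewrite (_ : _ - _ = (if (p - r)%N \in fs then p else 0%N)%:Z - (1 + (k %/ p)%N%:Z) * p%:Z).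
  by rewrite rpredB // dvdz_mull.
by rewrite -(subzn (ltnW rp)); ring.
Qed.

Lemma foldr_sumE (V : nmodType) h (g : nat -> V) :
  foldr (fun k x => g k + x) 0 (iota 1 h) = \sum_(i < h) g i.+1.
Proof.
rewrite (_ : foldr _ _ _ = \sum_(k <- iota 1 h) g k); last first.
  by elim: (iota 1 h) => [|k s IH] /=; rewrite ?big_nil // big_cons IH.
by rewrite (_ : iota 1 h = index_iota 1 h.+1) ?big_add1 ?big_mkord // /index_iota subn1.
Qed.

Lemma orthogonal_modP h : let p := h.*2.+1 in orthogonal_mod p ->
  exists O : 'M[int]_h, [/\ O^T = O, O *m O = (p%:Z ^+ 2)%:M
    & forall r i, O r i - r.+1%:Z * i.+1%:Z \in dvdz p%:Z].
Proof.
move=> p Op; pose w k := signed_residue p (flips p) k.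
exists (\matrix_(r, i) w (r.+1 * i.+1)%N); split=> [||r i].
- by apply/matrixP => r i; rewrite !mxE mulnC.
- apply/matrixP => r i; rewrite !mxE.
  have half : p./2 = h by rewrite /p /= uphalf_double.
  have mem_h (k : 'I_h) : k.+1 \in iota 1 h by rewrite mem_iota; have := ltn_ord k; lia.
  move: Op; rewrite /orthogonal_mod half => /allP/(_ _ (mem_h r))/allP/(_ _ (mem_h i)).
  rewrite (foldr_sumE _ h (fun k => w (r.+1 * k)%N * w (k * i.+1)%N)) => /eqP E.
  under eq_bigr => k _ do rewrite !mxE.
  by rewrite E eqSS; case: eqVneq => [/val_inj ->|ri]; rewrite ?eqxx // -val_eqE (negPf ri).
- by rewrite mxE -PoszM; apply: signed_residue_mod.
Qed.

Local Close Scope ring_scope.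

Theorem theorem1 (m j m0 : nat) (hj : 1 <= j) (hm0 : odd m0)
    (hm : m = 2 ^ j * m0) (Bs : seq nat) (hBs : (m, Bs) \in congruence_cases)
    (B : nat) (hB : B \in Bs) (n : nat) :
  regular_partitions m (m0 ^ 2 * n + m0 * B - beta m0)
    = multipartitions (m0 - 2 ^ j) (m0 * n + B) %[mod 2].
Proof.
have m0_gt0 := odd_gt0 hm0.
have logm : logn 2 m = j.
  by rewrite hm lognM ?expn_gt0 // pfactorK // logn_coprime ?addn0 // coprime2n.
have := allP congruence_cases_admissible _ hBs.
rewrite /admissible /= logm [in (m %/ _)]hm mulKn ?expn_gt0 //.
case/and5P=> p_pr orth j_small beta_small /andP[/eqP squares] /allP/(_ B hB)/andP[B0 /allP B_res].
have [h m0E] : exists h, m0 = h.*2.+1 by exists m0./2; rewrite -[LHS]odd_double_half hm0.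
have halfE : m0./2 = h by rewrite m0E /= uphalf_double.
have beta_le : beta m0 <= m0 * (m0 * n + B) by nia.
have [F [z [F2 prim_z]]] := char2_prim_root m0 p_pr hm0.
have sumsq : \sum_(i < h) i.+1 ^ 2 = m0 * beta m0.
  by rewrite -squares halfE -(foldr_sumE nat _ (fun i => i ^ 2)).
(* The multiple [m0 * n] vanishes modulo [m0], leaving the tested condition on [B]. *)
have K_res r : r < m0 ->
    2 * (m0 * n + B) != 2 ^ j * (r * (3 * r + 1)) %[mod m0].
  by move=> rm; rewrite mulnDr mulnCA mulnC modnMDl; apply: B_res; rewrite mem_iota.
(* This gives the argument the form [p K - b] with [K = m0 * n + B]. *)
rewrite (_ : m0 ^ 2 * n + m0 * B = m0 * (m0 * n + B)); last by rewrite expnS expn1; nia.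
rewrite hm; apply: (natr_eq_mod2 F) => //.
subst m0.
have [O [Osym Osqr Omod]] := orthogonal_modP _ orth.
exact: (regular_multipartitions F _ j (beta _) _ z O).
Qed.
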